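(* Let $V:f=0$ be a reduced plane curve of degree $d$ in $\mathbb{P}^2$, where $f\in\mathbb{C}[x,y,z]$ is homogeneous of degree $d$, essentially involves the three variables, and has Waring rank $r\geq 4$. Suppose that $f=\ell_1^d+\cdots+\ell_r^d$ is a Waring decomposition $(\mathcal{D})$ of $f$ such that the associated line arrangement $\mathcal{A}_{\mathcal{D}}:\ell_1\cdots\ell_r=0$ in $\mathbb{P}^2$ has a point of multiplicity $r-1$. Then the curve $V$ is either smooth or has only singularities of type $v^m+w^d=0$ (in local analytic coordinates $(v,w)$), with $2\leq m\leq r-2$. Moreover, in this case $r\leq d+1$.
   Context: The Waring rank of a homogeneous polynomial $f$ of degree $d$ over $\mathbb{C}$ is the minimal $r$ such that $f=\ell_1^d+\cdots+\ell_r^d$ with linear forms $\ell_j$; such an expression with $r$ minimal is called a Waring decomposition. The form $f$ essentially involves the variables $x,y,z$ if it cannot be written, after a linear change of coordinates, as a polynomial in fewer than three variables; equivalently the $\ell_j$ span the space of all linear forms, i.e. the line arrangement $\ell_1\cdots\ell_r=0$ is essential. The multiplicity of a point in a line arrangement is the number of lines of the arrangement passing through it. The integer $m$ may depend on the singular point. *)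

(* Defs.v *)
From HB Require Import structures.
From mathcomp Require Import all_boot all_order all_algebra complex.
From mathcomp Require Import all_classical all_reals all_analysis.
From mathcomp Require mpoly.
(* The notations of mpoly clash with those of MathComp-Analysis. *)
Import -(notations) mpoly.

Set Implicit Arguments.
Unset Strict Implicit.
Unset Printing Implicit Defensive.

Import Order.TTheory GRing.Theory Num.Theory.
Import numFieldNormedType.Exports.

Local Open Scope classical_set_scope.
Local Open Scope card_scope.
Local Open Scope ring_scope.

Notation "{ 'mpoly' T [ n ] }" := (mpoly n T) : type_scope.
Notation "d .-homog" := (ishomog1 d mdeg)
  (at level 1, format "d .-homog") : form_scope.

Section Waring.
Context {R : realType} {n : nat}.
Implicit Types (f : {mpoly R[i][n]}) (d r : nat).

Definition power_sum_decomposition d f r (l : 'I_r -> {mpoly R[i][n]}) : Prop :=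
  (forall j, l j \is 1.-homog) /\ f = \sum_j l j ^+ d.

Definition has_waring_rank d f r : Prop :=
  (exists l : 'I_r -> {mpoly R[i][n]}, power_sum_decomposition d f l) /\
  (forall s (l : 'I_s -> {mpoly R[i][n]}),
     power_sum_decomposition d f l -> (r <= s)%N).

Definition waring_decomposition d f r (l : 'I_r -> {mpoly R[i][n]}) : Prop :=
  has_waring_rank d f r /\ power_sum_decomposition d f l.

(* f(A x), where x is the column vector of the variables *)
Definition linear_change (A : 'M[R[i]]_n) f : {mpoly R[i][n]} :=
  comp_mpoly [tuple \sum_j A i j *: mpolyX R[i] (mnm1 j) | i < n] f.

Definition omits_variable f (k : 'I_n) : Prop :=
  forall m, m \in msupp f -> m k = 0%N.

Definition essentially_involves_all_variables f : Prop :=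
  ~ exists A : 'M[R[i]]_n,
      A \in unitmx /\ exists k, omits_variable (linear_change A f) k.

(* f has no multiple factor; for n > 0 this excludes f = 0. *)
Definition reduced f : Prop :=
  forall g h, f = g ^+ 2 * h -> exists c, g = mpolyC n c.

End Waring.

(* Points of P^2 are given by homogeneous coordinates p : 'rV[R[i]]_3 with
   p != 0, and subsets of P^2 by the corresponding cones in 'rV[R[i]]_3. *)
Section Plane.
Context {R : realType}.
Implicit Types (f : {mpoly R[i][3]}) (p : 'rV[R[i]]_3).

Definition zero_locus f : set 'rV[R[i]]_3 := [set p | meval (p 0) f = 0].

Definition line_arrangement r (l : 'I_r -> {mpoly R[i][3]}) :
  set (set 'rV[R[i]]_3) := range (fun j => zero_locus (l j)).

Definition has_multiplicity (A : set (set 'rV[R[i]]_3)) p (k : nat) : Prop :=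
  [set L | A L /\ L p] #= `I_k.

Definition singular_point f p : Prop :=
  [/\ p != 0, zero_locus f p & forall k, zero_locus (mderiv k f) p].

Definition smooth_curve f : Prop := forall p, ~ singular_point f p.

(* The standard affine chart of P^2 where the k-th coordinate is nonzero:
   chart_point k p are the affine coordinates of p, and chart_inv k q the
   homogeneous coordinates (k-th one equal to 1) of the affine point q. *)
Definition chart_point (k : 'I_3) p : R[i]^o * R[i]^o :=
  (p 0 (lift k (0 : 'I_2)) / p 0 k, p 0 (lift k (1 : 'I_2)) / p 0 k).

Definition chart_inv (k : 'I_3) (q : R[i]^o * R[i]^o) : 'I_3 -> R[i] :=
  fun j => if unlift k j is Some j' then
             (if j' == 0 :> 'I_2 then q.1 else q.2)
           else 1.

(* Over the scalar field R[i], differentiable means complex differentiable. *)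
Definition holomorphic_on (V W : normedModType R[i]) (U : set V) (g : V -> W) :
  Prop := forall x, U x -> differentiable g x.

(* phi = (v, w) is a system of analytic coordinates on the open set U, centred
   at q. *)
Definition analytic_coordinates (q : R[i]^o * R[i]^o)
    (U : set (R[i]^o * R[i]^o)) (phi : R[i]^o * R[i]^o -> R[i]^o * R[i]^o) :
  Prop :=
  [/\ open U, U q, phi q = (0, 0), holomorphic_on U phi &
   exists (W : set (R[i]^o * R[i]^o))
          (psi : R[i]^o * R[i]^o -> R[i]^o * R[i]^o),
     [/\ open W, holomorphic_on W psi,
         forall x, U x -> W (phi x) /\ psi (phi x) = x &
         forall y, W y -> U (psi y) /\ phi (psi y) = y]].

(* The germ at q of the analytic curve F = 0 has the equation v^m + w^d = 0 in
   suitable local coordinates (v, w), i.e. F is v^m + w^d up to a unit. *)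
Definition germ_of_type (m d : nat) (F : R[i]^o * R[i]^o -> R[i]^o)
    (q : R[i]^o * R[i]^o) : Prop :=
  exists (U : set (R[i]^o * R[i]^o))
         (phi : R[i]^o * R[i]^o -> R[i]^o * R[i]^o)
         (u : R[i]^o * R[i]^o -> R[i]^o),
    [/\ analytic_coordinates q U phi, holomorphic_on U u,
        forall x, U x -> u x != 0 &
        forall x, U x -> F x = u x * ((phi x).1 ^+ m + (phi x).2 ^+ d)].

Definition singularity_of_type (m d : nat) f p : Prop :=
  singular_point f p /\
  forall k : 'I_3, p 0 k != 0 ->
    germ_of_type m d (fun q => meval (chart_inv k q) f) (chart_point k p).

End Plane.

(* Main.v *)
Require Import Defs.
From HB Require Import structures.
From mathcomp Require Import all_boot all_order all_algebra complex.
From mathcomp Require Import separable cyclotomic.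
From mathcomp Require Import all_classical all_reals all_analysis.
From mathcomp Require mpoly.
Import -(notations) mpoly.
From mathcomp Require Import ring.
Set Implicit Arguments.
Unset Strict Implicit.
Unset Printing Implicit Defensive.
Import Order.TTheory GRing.Theory Num.Theory.
Import numFieldNormedType.Exports.
Local Open Scope classical_set_scope.
Local Open Scope card_scope.
Local Open Scope ring_scope.

(** Let [p0] be the point of multiplicity [r - 1] and [l_0] the one form that
does not vanish at [p0]: one exists because [f] is essential, and only one
because [r - 1] lines already pass through [p0]. In a basis [(q, e, p)] of the
space with [p] on the line of [p0] and [l_0 (q) = l_0 (e) = 0], with coordinates
[X, Y, Z], the form becomes
[f = Z ^ d + g(X, Y)], where [g = sum over j <> 0 of (a_j X + b_j Y) ^ d]. Up
to binomial factors the coefficients of the binary form [g] are the moments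
[S_k = sum_j a_j ^ (d - k) b_j ^ k].

_The bound on [r]._ A binary form of degree [d > 0] is a sum of [d] powers
([binary_form_rank_le]); since [r] is minimal, [r <= 1 + d].

_The singular points._ The derivative of [f] along [p] is [d Z ^ (d - 1)], so a
singular point [q] lies on [l_0 = 0] and can be taken as the first vector of the
basis, with the same point [p] ([adapted_basis]). Being singular then means
[S_0 = S_1 = 0]. Let [m] be the first index with [S_m <> 0]; it is the
multiplicity of [q] as a root of [g]. If all of [S_0, ..., S_(r-2)] vanished,
then so would every [S_k] with [k < d], because the moments of [r - 1] forms
satisfy a linear recurrence of length at most [r - 1] ([moments_vanish]); then
[f = Z ^ d + S_d Y ^ d] would be a sum of two powers, against [r >= 4]. Hence
[2 <= m <= r - 2].

_The local equation._ In the affine coordinates [t = Y / X], [w = Z / X] centred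
at [q],
[f / X ^ d = t ^ m h(t) + w ^ d = h(t) (t ^ m + (w rho(t)) ^ d)],
where [h] is a polynomial with [h(0) <> 0] and [rho] is a holomorphic [d]-th
root of [1 / h] near [0] ([holomorphic_poly_root]). Absorbing [h] into [w]
rather than into [t] gives coordinates [(t, w rho(t))] whose inverse
[(a, b) -> (a, b / rho(a))] is explicit ([germ_of_type_adapted]). *)

(** * Sums of powers of binary linear forms *)

Section Binary.
Variables (C : numClosedFieldType) (d : nat).

(** The coefficients, up to binomial factors, of the binary form
[sum_j (a_j x + b_j y) ^ d]. *)
Definition moment (I : finType) (P : pred I) (a b : I -> C) (k : nat) : C :=
  \sum_(j | P j) a j ^+ (d - k) * b j ^+ k.

(** Stated in an arbitrary commutative algebra because [x] and [y] are used both
as linear forms in three variables and as [1] and ['X]. *)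
Lemma sum_powers_moments (A : comAlgType C) (I : finType) (P : pred I)
    (a b : I -> C) (x y : A) :
  \sum_(j | P j) (a j *: x + b j *: y) ^+ d =
  \sum_(k < d.+1) moment P a b k *: (x ^+ (d - k) * y ^+ k *+ 'C(d, k)).
Proof.
under eq_bigr do rewrite exprDn.
rewrite exchange_big /=; apply: eq_bigr => k _.
rewrite /moment scaler_suml; apply: eq_bigr => j _.
by rewrite !exprZn -scalerAl -scalerAr scalerA scalerMnr.
Qed.

Lemma coef_binary_poly (I : finType) (P : pred I) (a b : I -> C) k : (k <= d)%N ->
  (\sum_(j | P j) (a j *: 1 + b j *: 'X : {poly C}) ^+ d)`_k =
  moment P a b k *+ 'C(d, k).
Proof.
rewrite -ltnS => kd; rewrite sum_powers_moments coef_sum.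
rewrite (bigD1 (Ordinal kd)) //= big1 => [|i ik].
  by rewrite coefZ expr1n mul1r coefMn coefXn eqxx addr0 mulrnAr mulr1.
rewrite coefZ expr1n mul1r coefMn coefXn -val_eqE /= eq_sym in ik *.
by rewrite (negbTE ik) mul0rn mulr0.
Qed.

(** The exponent [m] is the multiplicity of the binary form at the point [y = 0]
of the projective line. *)
Lemma binary_poly_order (I : finType) (P : pred I) (a b : I -> C) m : (m <= d)%N ->
  (forall k, (k < m)%N -> moment P a b k = 0) -> moment P a b m != 0 ->
  exists2 h : {poly C}, h.[0] != 0 &
    \sum_(j | P j) (a j *: 1 + b j *: 'X : {poly C}) ^+ d = 'X^m * h.
Proof.
move=> md S0 Sm.
pose G : {poly C} := \sum_(j | P j) (a j *: 1 + b j *: 'X : {poly C}) ^+ d.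
exists (drop_poly m G).
  by rewrite horner_coef0 coef_drop_poly add0n coef_binary_poly // mulrn_eq0
             eqn0Ngt bin_gt0 md.
rewrite -/G -[LHS](poly_take_drop m) mulrC [take_poly _ _](_ : _ = 0) ?add0r //.
apply/polyP => k; rewrite coef_take_poly coef0; case: ifP => // km.
by rewrite coef_binary_poly ?S0 ?mul0rn // ltnW // (leq_trans km).
Qed.

(** For [k < d] the moments are the values [phi ('X^k)] of the functional
[phi (p) = sum_j a_j ^ d p(b_j / a_j)], the forms with [a_j = 0] contributing
nothing. Since [phi] kills the multiples of [q = prod_j ('X - b_j / a_j)], it is
determined by its values on polynomials of degree less than the number of forms,
where it is zero by hypothesis. *)
Lemma moments_vanish (I : finType) (P : pred I) (a b : I -> C) :
  (#|P| <= d)%N -> (forall k, (k < #|P|)%N -> moment P a b k = 0) ->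
  forall k, (k < d)%N -> moment P a b k = 0.
Proof.
move=> lePd S0.
pose Q := [pred j | P j && (a j != 0)].
pose phi (p : {poly C}) := \sum_(j | Q j) a j ^+ d * p.[b j / a j].
have momE k : (k < d)%N -> moment P a b k = phi 'X^k.
  move=> kd; rewrite /moment /phi big_mkcondr /=; apply: eq_bigr => j Pj.
  have [->|aj0] := eqVneq (a j) 0; first by rewrite expr0n subn_eq0 leqNgt kd mul0r.
  rewrite hornerXn expr_div_n -{2}(subnK (ltnW kd)) exprD -mulrA; congr (_ * _).
  by rewrite mulrC divfK // expf_neq0.
have phi_small (p : {poly C}) : (size p <= #|P|)%N -> phi p = 0.
  move=> szp; rewrite /phi.
  under eq_bigr do rewrite (horner_coef_wide _ szp) mulr_sumr.
  rewrite exchange_big big1 // => i _; under eq_bigr do rewrite mulrCA.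
  rewrite -mulr_sumr.
  have := momE i (leq_trans (ltn_ord i) lePd); rewrite S0 // /phi.
  by under eq_bigr do rewrite hornerXn; move=> <-; rewrite mulr0.
pose q := \prod_(t <- [seq b j / a j | j <- enum Q]) ('X - t%:P).
have sz_q : (size q <= #|P|.+1)%N.
  rewrite /q size_prod_XsubC size_map -cardE ltnS.
  by apply: subset_leq_card; apply/fintype.subsetP => j /andP[].
have q_neq0 : q != 0 by rewrite monic_neq0 // monic_prod_XsubC.
move=> k /momE ->; rewrite -[RHS](phi_small ('X^k %% q)); last first.
  by rewrite -ltnS (leq_trans _ sz_q) // ltn_modpN0.
apply: eq_bigr => j Qj; congr (_ * _).
rewrite {1}(divp_eq 'X^k q) hornerD hornerM [q.[_]](_ : _ = 0) ?mulr0 ?add0r //.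
by apply/rootP; rewrite root_prod_XsubC; apply/mapP; exists j; rewrite ?mem_enum.
Qed.

Lemma nonzero_poly_value (p : {poly C}) : p != 0 -> exists t, p.[t] != 0.
Proof.
move=> p0; have /allPn[t _ pt] : ~~ all (root p) [seq i%:R | i <- iota 0 (size p)].
  apply/negP => /(max_poly_roots p0) /(_ _); rewrite size_map size_iota ltnn.
  rewrite map_inj_uniq ?iota_uniq; first by move=> /(_ isT).
  by move=> i j /eqP; rewrite eqr_nat => /eqP.
by exists t.
Qed.

(** The Vandermonde matrix of the [d] distinct [d]-th roots of unity is
invertible. *)
Lemma unity_roots_interpolation (T : nat -> C) : (0 < d)%N ->
  exists w c : 'I_d -> C, (forall i, w i ^+ d = 1) /\
    forall k, (k < d)%N -> \sum_i c i * w i ^+ k = T k.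
Proof.
move=> d0.
have [rs rsE] := closed_field_poly_normal ('X^d - 1 : {poly C}).
have lc : lead_coef ('X^d - 1 : {poly C}) = 1.
  by apply/monicP; rewrite -polyC1 monicXnsubC.
rewrite lc scale1r in rsE.
have sz : size rs == d.
  by rewrite -eqSS -(size_prod_XsubC _ id) -rsE -polyC1 size_XnsubC.
have urs : uniq rs.
  by rewrite -separable_prod_XsubC -rsE separable_Xn_sub_1 // pnatr_eq0 -lt0n.
pose a : 'rV[C]_d := \row_i rs`_i.
have aP i : a 0 i ^+ d = 1.
  apply/eqP; rewrite -subr_eq0 -[X in X == 0](_ : ('X^d - 1).[a 0 i] = _).
    by rewrite rsE -/(root _ _) root_prod_XsubC mxE mem_nth // (eqP sz).
  by rewrite !hornerE.
pose V := Vandermonde d a.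
have uV : V \in unitmx.
  rewrite unitmxE det_Vandermonde unitfE; apply/prodf_neq0 => i _.
  apply/prodf_neq0 => j ij; rewrite subr_eq0 !mxE nth_uniq ?(eqP sz) //.
  by rewrite neq_ltn ij orbT.
pose c := invmx V *m (\col_k T k).
exists (a 0), (c^~ 0); split => // k kd.
have := mulKVmx uV (\col_k0 T k0); move=> /matrixP /(_ (Ordinal kd) 0).
rewrite !mxE /= => <-; apply: eq_bigr => i _; rewrite [V _ _]mxE.
by rewrite mulrC.
Qed.

(** Change of basis of the linear forms, as it occurs in
[binary_form_rank_le]. *)
Lemma scale_substitution (V : lmodType C) (u v p q r t : C) (x y : V) :
  u *: (p *: x - q *: y) + v *: (r *: y - t *: x) =
  (u * p - v * t) *: x + (v * r - u * q) *: y.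
Proof.
rewrite !scalerBr !scalerA !scalerBl [X in _ + X = _]addrC addrACA.
by congr (_ + _); rewrite addrC.
Qed.

(** A nonzero form [g] takes equal nonzero values at two independent vectors:
two points with [g <> 0] exist, and one of them can be rescaled. In the dual
coordinates [x', y'] the coefficients of [x' ^ d] and [y' ^ d] agree, so the
moments [S'_0, ..., S'_d] extend to a [d]-periodic sequence and can be
interpolated by the powers of the [d]-th roots of unity [w_i]:
[S'_k = sum_i c_i w_i ^ k], that is [g = sum_i c_i (x' + w_i y') ^ d]. *)
Lemma binary_form_rank_le (I : finType) (P : pred I) (a b : I -> C) :
  (0 < d)%N ->
  exists c e : 'I_d -> C, forall (A : comAlgType C) (x y : A),
    \sum_(j | P j) (a j *: x + b j *: y) ^+ d =
    \sum_i (c i *: x + e i *: y) ^+ d.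
Proof.
move=> d0; pose G : {poly C} := \sum_(j | P j) (a j *: 1 + b j *: 'X) ^+ d.
have GE t : G.[t] = \sum_(j | P j) (a j + b j * t) ^+ d.
  rewrite horner_sum; apply: eq_bigr => j _.
  by rewrite horner_exp hornerD !hornerZ hornerX hornerC mulr1.
have [G0|G_neq0] := eqVneq G 0.
  exists (fun=> 0), (fun=> 0) => A x y; rewrite sum_powers_moments.
  rewrite [RHS]big1 => [|i _]; last first.
    by rewrite !scale0r add0r expr0n eqn0Ngt d0.
  rewrite big1 // => k _; have kd : (k <= d)%N by rewrite -ltnS.
  have /eqP := coef_binary_poly P a b kd; rewrite -/G G0 coef0 eq_sym.
  by rewrite mulrn_eq0 eqn0Ngt bin_gt0 kd => /eqP ->; rewrite scale0r.
(* The factor 'X - t1 forces the second point to differ from the first. *)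
have [t1 Gt1] := nonzero_poly_value G_neq0.
have [t2] := nonzero_poly_value (mulf_neq0 G_neq0 (monic_neq0 (monicXsubC t1))).
rewrite hornerM hornerXsubC mulf_eq0 negb_or subr_eq0 => /andP[Gt2 t21].
pose s := d.-root (G.[t1] / G.[t2]).
have sE : s ^+ d = G.[t1] / G.[t2] by rewrite rootCK.
have s0 : s != 0 by rewrite rootC_eq0 // mulf_neq0 // invr_eq0.
(* a' and b' are the values of the linear forms at (1, t1) and s (1, t2). *)
pose a' j := a j + b j * t1; pose b' j := s * (a j + b j * t2).
have S'd : moment P a' b' d = moment P a' b' 0.
  rewrite /moment subn0 subnn.
  under eq_bigr do rewrite expr0 mul1r exprMn.
  under [RHS]eq_bigr do rewrite expr0 mulr1.
  by rewrite -mulr_sumr sE -!GE divfK.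
have [w [c [w1 cS]]] := unity_roots_interpolation (moment P a' b') d0.
pose g i := d.-root (c i); pose D := t2 - t1.
have D0 : D != 0 by rewrite subr_eq0.
exists (fun i => g i * t2 / D - g i * w i * t1 / (s * D)).
exists (fun i => g i * w i / (s * D) - g i / D) => A x y.
pose x' := (t2 / D) *: x - D^-1 *: y.
pose y' := (s * D)^-1 *: y - (t1 / (s * D)) *: x.
transitivity (\sum_(j | P j) (a' j *: x' + b' j *: y') ^+ d).
  apply: eq_bigr => j _; congr (_ ^+ d).
  rewrite /x' /y' scale_substitution /a' /b' /D.
  by congr (_ *: _ + _ *: _); field; rewrite subr_eq0 t21 s0.
transitivity (\sum_i (g i *: x' + (g i * w i) *: y') ^+ d); last first.
  apply: eq_bigr => i _; congr (_ ^+ d).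
  rewrite /x' /y' scale_substitution.
  by congr (_ *: _ + _ *: _); field; rewrite subr_eq0 t21 s0.
rewrite !sum_powers_moments; apply: eq_bigr => k _; congr (_ *: _).
transitivity (\sum_i c i * w i ^+ k).
  have := ltn_ord k; rewrite ltnS leq_eqVlt => /orP[/eqP->|/cS -> //].
  by rewrite S'd -cS //; apply: eq_bigr => i _; rewrite w1 expr0.
rewrite /moment; apply: eq_bigr => i _.
by rewrite exprMn mulrA -exprD subnK -1?ltnS // rootCK.
Qed.
End Binary.

(** * Holomorphic roots of functions *)

Section Differentiability.
Variables (K : numFieldType) (V : normedModType K).
Implicit Types (f g : V -> K^o) (x : V).

Lemma differentiable_mul f g x : differentiable f x -> differentiable g x ->
  differentiable (fun y => f y * g y : K^o) x.
Proof. by move=> df dg; exact: (differentiableM df dg). Qed.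

Lemma differentiable_exp f n x :
  differentiable f x -> differentiable (fun y => f y ^+ n : K^o) x.
Proof.
move=> df; elim: n => [|n IHn]; first exact: differentiable_cst.
by under eq_fun do rewrite exprS; exact: differentiable_mul.
Qed.

Lemma differentiable_bigsum n (f : 'I_n -> V -> K^o) x :
  (forall i, differentiable (f i) x) ->
  differentiable (fun y => \sum_i f i y : K^o) x.
Proof.
move=> df; rewrite (_ : (fun y => _) = \sum_i f i).
  exact: differentiable_sum.
by apply/funext => y; rewrite fct_sumE.
Qed.

Lemma differentiable_horner (p : {poly K}) f x :
  differentiable f x -> differentiable (fun y => p.[f y] : K^o) x.
Proof.
move=> df; under eq_fun do rewrite horner_coef.
apply: differentiable_bigsum => i.
by apply: differentiable_mul; [exact: differentiable_cst | exact: differentiable_exp].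
Qed.

Lemma differentiable_div f g x : differentiable f x -> differentiable g x ->
  g x != 0 -> differentiable (fun y => f y / g y : K^o) x.
Proof.
by move=> df dg gx; apply: differentiable_mul => //; exact: differentiableV.
Qed.

End Differentiability.

Section Projections.
Variables (K : numFieldType) (V W : normedModType K).

Lemma differentiable_fst (x : V * W) : differentiable (fst : V * W -> V) x.
Proof. by apply: (@linear_differentiable _ _ _ fst) => p; exact: cvg_fst. Qed.

Lemma differentiable_snd (x : V * W) : differentiable (snd : V * W -> W) x.
Proof. by apply: (@linear_differentiable _ _ _ snd) => p; exact: cvg_snd. Qed.
End Projections.

Section Root.
Variable (C : numClosedFieldType).

(** The [d] roots [w] of [X ^ d - z] satisfy [prod (1 - w) = 1 - z], so they
cannot all be at distance at least [e] from [1]. *)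
Lemma root_near_one d (z e : C) : (0 < d)%N -> 0 < e -> `|1 - z| < e ^+ d ->
  exists2 w, w ^+ d = z & `|1 - w| < e.
Proof.
move=> d0 e0 ze.
have [rs rsE] := closed_field_poly_normal ('X^d - z%:P : {poly C}).
have lc : lead_coef ('X^d - z%:P : {poly C}) = 1 by apply/monicP; rewrite monicXnsubC.
rewrite lc scale1r in rsE.
have sz : size rs = d.
  by apply/eqP; rewrite -eqSS -(size_prod_XsubC _ id) -rsE size_XnsubC.
have [/hasP[w wrs we]|/hasPn far] := boolP (has (fun w => `|1 - w| < e) rs).
  exists w => //; apply/eqP; rewrite -subr_eq0.
  have : root ('X^d - z%:P) w by rewrite rsE root_prod_XsubC.
  by rewrite /root !hornerE.
move: ze; rewrite -sz; have -> : 1 - z = \prod_(w <- rs) (1 - w).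
  have := congr1 (fun p => p.[1]) rsE; rewrite !hornerE expr1n => ->.
  by rewrite horner_prod; apply: eq_bigr => w _; rewrite !hornerE.
suff /le_lt_trans/[apply] : e ^+ size rs <= `|\prod_(w <- rs) (1 - w)|.
  by rewrite ltxx.
elim: rs far {rsE sz} => [|w rs IHrs] far; first by rewrite big_nil normr1.
rewrite big_cons normrM exprS ler_pM ?exprn_ge0 ?(ltW e0) //.
  by rewrite real_leNgt ?far ?mem_head // ?normr_real // gtr0_real.
by apply: IHrs => v vrs; apply: far; rewrite inE vrs orbT.
Qed.

(** Write [w ^ d - v ^ d = (w - v) S (w, v)]. As [S (1, 1) = d] is not zero, [S]
is bounded away from zero for [w] and [v] close to [1]. Any choice [rho] of a
[d]-th root close to [1] is therefore Lipschitz, hence continuous, and its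
difference quotients [1 / S (rho (z + h), rho z)] converge. *)
Lemma holomorphic_root_near_one d : (0 < d)%N ->
  exists (N : set C^o) (rho : C^o -> C^o), [/\ open N, N 1 &
    forall z, N z -> rho z ^+ d = z /\ differentiable rho z].
Proof.
move=> d0.
pose S (p : C^o * C^o) : C^o := \sum_(i < d) p.1 ^+ (d.-1 - i) * p.2 ^+ i.
have dS p : differentiable S p.
  by apply: differentiable_bigsum => i; apply: differentiable_mul;
     apply: differentiable_exp; [exact: differentiable_fst | exact: differentiable_snd].
have cS p : S q @[q --> p] --> S p by exact: differentiable_continuous.
have SE (w v : C^o) : w ^+ d - v ^+ d = (w - v) * S (w, v) by rewrite subrXX.
have S1 : 2^-1 < `|S (1, 1)|.
  rewrite /S /=; under eq_bigr do rewrite !expr1n mulr1.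
  rewrite sumr_const card_ord normr_nat.
  by rewrite (@lt_le_trans _ _ 1) ?ler1n // invf_lt1 ?ltr1n.
have : nbhs ((1, 1) : C^o * C^o) [set p | 2^-1 < `|S p|].
  exact: cvgr_norm_gt (cS (1, 1)) _ S1.
move=> /nbhs_ballP[e /= e0 He].
pose N : set C^o := ball (1 : C^o) (e ^+ d).
pose rho (z : C^o) : C^o := xget 1 [set w : C^o | w ^+ d = z /\ `|1 - w| < e].
have rhoP z : N z -> rho z ^+ d = z /\ `|1 - rho z| < e.
  move=> Nz; have [w wz we] := root_near_one d0 e0 Nz.
  by rewrite /rho; case: xgetP => [? _ //|/(_ w)[]].
have S_ge z z' : N z -> N z' -> 2^-1 < `|S (rho z', rho z)|.
  by move=> /rhoP[_ ez] /rhoP[_ ez']; apply: He; split.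
have oN : open N by exact: ball_open.
have lip z z' : N z -> N z' -> `|rho z' - rho z| <= 2 * `|z' - z|.
  move=> Nz Nz'; rewrite -{2}(rhoP _ Nz).1 -{2}(rhoP _ Nz').1 SE normrM.
  rewrite mulrC -mulrA ler_peMr // mulrC -ler_pdivrMl // mulr1.
  exact/ltW/S_ge.
have crho z : N z -> rho z' @[z' --> z] --> rho z.
  move=> Nz; apply/(cvgrPdistC_lt (F := nbhs (z : C^o))) => eps eps0; near=> z'.
  have Nz' : N z' by near: z'; exact: open_nbhs_nbhs.
  apply: (le_lt_trans (lip _ _ Nz Nz')); rewrite -ltr_pdivlMl //.
  near: z'; apply/nbhs_ballP; exists (2^-1 * eps) => /=; first by rewrite mulr_gt0.
  by move=> y; rewrite -ball_normE /= distrC.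
exists N, rho; split => //; first by apply: ballxx; rewrite exprn_gt0.
move=> z Nz; split; first exact: (rhoP _ Nz).1.
have Sz0 : S (rho z, rho z) != 0.
  by rewrite -normr_gt0 (lt_trans _ (S_ge _ _ Nz Nz)) // invr_gt0.
apply/derivable1_diffP; apply/cvg_ex; exists (S (rho z, rho z))^-1.
have shz : (h + z) @[h --> (0 : C^o)^'] --> z.
  rewrite -[X in _ --> X]add0r; apply: cvgD; last exact: cvg_cst.
  exact: nbhs_dnbhs.
apply: (@cvg_trans _ ((S (rho (h + z), rho z))^-1 @[h --> (0 : C^o)^'])).
  apply: near_eq_cvg; near=> h.
  have Nh : N (h + z) by near: h; exact: (shz _ (open_nbhs_nbhs (conj oN Nz))).
  have h0 : h != 0 by near: h; exact: nbhs_dnbhs_neq.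
  have Sh0 : S (rho (h + z), rho z) != 0.
    by rewrite -normr_gt0 (lt_trans _ (S_ge _ _ Nz Nh)) // invr_gt0.
  rewrite /= [h *: 1]mulr1 [_ *: _]mulrC; apply: (canRL (mulfK h0)).
  apply: (mulfI Sh0); rewrite mulrA mulfV // mul1r mulrC -SE.
  by rewrite (rhoP _ Nh).1 (rhoP _ Nz).1 addrK.
have rho_cvg : rho (h + z) @[h --> (0 : C^o)^'] --> rho z.
  apply: (cvg_comp (fun h => h + z) rho shz); exact: crho.
have pair_cvg : (fun h : C^o => (rho (h + z), rho z) : C^o * C^o)
    @ (0 : C^o)^' --> ((rho z, rho z) : C^o * C^o).
  exact: (cvg_pair rho_cvg (cvg_cst (rho z))).
have := cvg_comp (fun h => (rho (h + z), rho z)) S pair_cvg (cS (rho z, rho z)).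
by move=> /(@cvgV C _ _ _ _ _ Sz0).
Unshelve. all: by end_near.
Qed.

Lemma open_setI_preimage (V W : normedModType C) (A : set V) (D : set W)
    (g : V -> W) :
  open A -> open D -> (forall x, A x -> differentiable g x) ->
  open [set x | A x /\ D (g x)].
Proof.
move=> oA oD dg; rewrite openE => x [Ax Dgx].
have cg : g y @[y --> x] --> g x by apply: differentiable_continuous; exact: dg.
near=> y; split; near: y; first exact: open_nbhs_nbhs.
exact: (cg _ (open_nbhs_nbhs (conj oD Dgx))).
Unshelve. all: by end_near.
Qed.

Lemma open_neq0 : open [set z : C^o | z != 0].
Proof.
rewrite openE => z /= z0.
have := cvgr_neq0 (f := id) z (@cvg_id _ (nbhs z)) z0.
exact.
Qed.

(** The root of [1 / h] is taken as [s / rho (h(t) / h(0))], where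
[s ^ d = 1 / h(0)] and [rho] is the root near [1]. *)
Lemma holomorphic_poly_root (d : nat) (h : {poly C}) : (0 < d)%N -> h.[0] != 0 ->
  exists (B : set C^o) (rho : C^o -> C^o), [/\ open B, B 0 &
    forall t, B t -> rho t ^+ d * h.[t] = 1 /\ differentiable rho t].
Proof.
move=> d0 h0; have [N [rho [oN N1 rhoP]]] := holomorphic_root_near_one d0.
pose s := d.-root h.[0]^-1.
pose H (t : C^o) : C^o := h.[t] / h.[0].
have dH t : differentiable H t.
  apply: differentiable_mul; last exact: differentiable_cst.
  by apply: (differentiable_horner h (f := id)).
exists [set t | setT t /\ (N `&` [set z | z != 0]) (H t)].
exists (fun t => s / rho (H t)); split.
- apply: open_setI_preimage => //; first exact: openT.
  by apply: openI => //; exact: open_neq0.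
- by split => //; rewrite /H divff //; split => //=; exact: oner_neq0.
- move=> t [_ [NHt Ht0]]; have [rhoH drho] := rhoP _ NHt; split.
    rewrite expr_div_n rhoH rootCK // /H.
    by move: Ht0; rewrite /= mulf_eq0 negb_or => /andP[ht _]; field; rewrite h0 ht.
  apply: differentiable_div; first exact: differentiable_cst.
    exact: (differentiable_comp (dH t)).
  apply: contraNneq Ht0 => rH0; rewrite -rhoH rH0 expr0n.
  by case: (d) d0.
Qed.
End Root.

(** * Local equation in projective coordinates *)

Section Charts.
Context {R : realType}.
Implicit Types (k : 'I_3) (y : R[i]^o * R[i]^o) (x : 'rV[R[i]]_3).

Definition chart_vec k y : 'rV[R[i]]_3 := \row_j chart_inv k y j.

Lemma chart_vecE k y : chart_vec k y 0 k = 1.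
Proof. by rewrite mxE /chart_inv unlift_none. Qed.

Lemma chart_vec_point k x : x 0 k != 0 ->
  chart_vec k (chart_point k x) = (x 0 k)^-1 *: x.
Proof.
move=> xk; apply/rowP => j; rewrite !mxE /chart_inv.
case: unliftP => [j' ->|->]; last by rewrite mulVf.
have -> : (if j' == 0 :> 'I_2 then x 0 (lift k (0 : 'I_2)) / x 0 k
           else x 0 (lift k (1 : 'I_2)) / x 0 k) = x 0 (lift k j') / x 0 k.
  case: ifPn => [/eqP-> //|j0]; congr (x 0 (lift k _) / _).
  by apply: val_inj; case: j' j0 => [[|[]]].
by rewrite mulrC.
Qed.

Lemma chart_point_vec k y (a : R[i]) : a != 0 ->
  chart_point k (a *: chart_vec k y) = y.
Proof.
move=> a0; rewrite /chart_point !mxE /chart_inv !liftK unlift_none /= mulr1.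
by case: y => y1 y2 /=; rewrite ![a * _]mulrC !mulfK.
Qed.

Definition row3 (a b c : R[i]) : 'rV[R[i]]_3 := \row_j [:: a; b; c]`_j.

Lemma row3E x : x = row3 (x 0 0) (x 0 1) (x 0 2).
Proof.
by apply/rowP => -[[|[|[|j]]] j3] //; rewrite mxE; congr (x 0 _); apply: val_inj.
Qed.

Lemma differentiable_chart_vec k j y :
  differentiable (fun y => chart_vec k y 0 j : R[i]^o) y.
Proof.
under eq_fun do rewrite mxE /chart_inv.
case: (unlift k j) => [j'|]; last exact: differentiable_cst.
by case: (j' == 0); [exact: differentiable_fst | exact: differentiable_snd].
Qed.

Lemma differentiable_chart_coord k (A : 'M[R[i]]_3) j y :
  differentiable (fun y => (chart_vec k y *m A) 0 j : R[i]^o) y.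
Proof.
under eq_fun do rewrite mxE.
apply: differentiable_bigsum => i; apply: differentiable_mul.
  exact: differentiable_chart_vec.
exact: differentiable_cst.
Qed.

(** The coordinates are [v = t] and [w' = w rho(t)], with [t] and [w] the ratios
of the coordinates of the point in the basis [M]. Their inverse sends [(a, b)]
to the affine point of the vector [row 0 M + a row 1 M + (b / rho(a)) row 2 M],
wherever its [k]-th coordinate is not zero. *)
Lemma germ_of_type_adapted (m d : nat) (f : {mpoly R[i][3]}) (h : {poly R[i]})
    (M : 'M[R[i]]_3) k :
  (0 < d)%N -> h.[0] != 0 -> M \in unitmx -> M 0 k != 0 ->
  (forall x, let c := x *m invmx M in c 0 0 != 0 ->
     meval (x 0) f = c 0 0 ^+ d * ((c 0 1 / c 0 0) ^+ m * h.[c 0 1 / c 0 0] +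
                                (c 0 2 / c 0 0) ^+ d)) ->
  germ_of_type m d (fun y => meval (chart_inv k y) f) (chart_point k (row 0 M)).
Proof.
move=> d0 h0 uM Mk fE.
have [B [rho [oB B0 rhoP]]] := holomorphic_poly_root d0 h0.
have rho0 t : B t -> rho t != 0.
  move=> /rhoP[/eqP + _]; apply: contraTneq => ->.
  by rewrite expr0n eqn0Ngt d0 mul0r eq_sym oner_eq0.
have hn0 t : B t -> h.[t] != 0.
  by move=> /rhoP[/eqP + _]; apply: contraTneq => ->; rewrite mulr0 eq_sym oner_eq0.
pose c y := chart_vec k y *m invmx M.
pose X y : R[i]^o := c y 0 0; pose t y : R[i]^o := c y 0 1 / X y.
pose w y : R[i]^o := c y 0 2 / X y.
have dc j y : differentiable (fun y => c y 0 j : R[i]^o) y.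
  exact: differentiable_chart_coord.
pose U := [set y | [set y | X y != 0] y /\ B (t y)].
have oX : open [set y | X y != 0].
  have := open_setI_preimage openT (@open_neq0 R[i]) (fun y _ => dc 0 y).
  by congr open; apply/seteqP; split => y //= [].
have dt y : X y != 0 -> differentiable t y by
  exact: differentiable_div (dc 1 y) (dc 0 y).
have dw y : X y != 0 -> differentiable w y by
  exact: differentiable_div (dc 2 y) (dc 0 y).
have oU : open U by apply: open_setI_preimage.
pose phi y : R[i]^o * R[i]^o := (t y, w y * rho (t y)).
pose xi (z : R[i]^o * R[i]^o) := row3 1 z.1 (z.2 / rho z.1) *m M.
pose W := [set z | [set z : R[i]^o * R[i]^o | B z.1] z /\ (xi z 0 k : R[i]^o) != 0].
have cVK y : X y != 0 -> row3 1 (t y) (w y) = (X y)^-1 *: c y.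
  move=> Xy; rewrite [c y]row3E; apply/rowP => -[[|[|[|j]]] j3] //;
    rewrite [LHS]mxE [RHS]mxE [X in _ * X]mxE /=.
  - by rewrite mulVf.
  - by rewrite mulrC.
  - by rewrite mulrC.
have q_chart : chart_vec k (chart_point k (row 0 M)) = (M 0 k)^-1 *: row 0 M.
  by rewrite chart_vec_point !mxE.
have c_q : c (chart_point k (row 0 M)) = (M 0 k)^-1 *: row3 1 0 0.
  rewrite /c q_chart -scalemxAl -row_mul mulmxV //; congr (_ *: _).
  by apply/rowP => -[[|[|[|j]]] j3] //; rewrite !mxE.
have xi_phi y : U y -> xi (phi y) = (X y)^-1 *: chart_vec k y.
  move=> [Xy Bt]; rewrite /xi /= mulfK ?rho0 // cVK //.
  by rewrite -scalemxAl mulmxKV.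
have c_psi z : W z ->
    c (chart_point k (xi z)) = (xi z 0 k)^-1 *: row3 1 z.1 (z.2 / rho z.1).
  by move=> [_ xik]; rewrite /c chart_vec_point // -scalemxAl mulmxK.
have oB1 : open [set z : R[i]^o * R[i]^o | B z.1].
  have := open_setI_preimage openT oB (fun z _ => @differentiable_fst _ R[i]^o R[i]^o z).
  by congr open; apply/seteqP; split => y //= [].
have dxi z j : B z.1 -> differentiable (fun z => xi z 0 j : R[i]^o) z.
  move=> Bz; under eq_fun do rewrite mxE.
  apply: differentiable_bigsum => i.
  apply: differentiable_mul; last exact: differentiable_cst.
  under eq_fun do rewrite mxE; case: i => -[|[|[|i]]] i3 //=.
  - exact: differentiable_fst.
  - apply: differentiable_div; [exact: differentiable_snd| |exact: rho0].
    apply: (differentiable_comp (@differentiable_fst _ _ _ z)).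
    by have [] := rhoP _ Bz.
exists U, phi, (fun y => X y ^+ d * h.[t y]); split.
- split => //.
  + by split; rewrite /= /t /X c_q !mxE /= ?mulr1 ?invr_eq0 // mulr0 mul0r.
  + by rewrite /phi /t /w /X c_q !mxE /= mulr0 !mul0r.
  + move=> y [Xy Bt]; apply: differentiable_pair; first exact: dt.
    apply: differentiable_mul; first exact: dw.
    by apply: (differentiable_comp (dt _ Xy)); have [] := rhoP _ Bt.
  exists W, (fun z => chart_point k (xi z)); split.
  + exact: (open_setI_preimage oB1 (@open_neq0 R[i]) (fun z => dxi z k)).
  + move=> z [Bz xik]; apply: differentiable_pair;
      exact: differentiable_div (dxi z _ Bz) (dxi z _ Bz) xik.
  + move=> y Uy; have [Xy Bt] := Uy; split; last first.
      by rewrite xi_phi // chart_point_vec // invr_eq0.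
    split => //=; rewrite xi_phi // mxE chart_vecE mulr1 invr_eq0 //.
  + move=> z Wz; have [Bz xik] := Wz.
    have cz := c_psi z Wz.
    have Xz : X (chart_point k (xi z)) = (xi z 0 k)^-1 by rewrite /X cz !mxE mulr1.
    have tz : t (chart_point k (xi z)) = z.1.
      by rewrite /t Xz cz; move: (xi z 0 k) xik => s s0;
         rewrite !mxE /= mulrC mulKf ?invr_eq0.
    have wz : w (chart_point k (xi z)) = z.2 / rho z.1.
      by rewrite /w Xz cz; move: (xi z 0 k) xik => s s0;
         rewrite !mxE /= mulrC mulKf ?invr_eq0.
    split; first by split; rewrite ?tz //= Xz invr_eq0.
    by rewrite /phi tz wz divfK ?rho0 //; case: (z).
- move=> y [Xy Bt]; apply: differentiable_mul.
    exact: (differentiable_exp d (dc 0 y)).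
  exact: (differentiable_horner h (dt y Xy)).
- by move=> y [Xy Bt]; rewrite mulf_neq0 ?expf_neq0 // hn0.
- move=> y [Xy Bt]; rewrite (@meval_eq _ _ _ (chart_vec k y 0)); last first.
    by move=> j; rewrite mxE.
  rewrite (fE (chart_vec k y) Xy) -/(c y) -/(X y) -/(t y) -/(w y) /= -mulrA.
  congr (_ * _); rewrite mulrDr [X in _ = X + _]mulrC; congr (_ + _).
  by rewrite [in RHS]exprMn mulrCA [_ * rho _ ^+ _]mulrC (rhoP _ Bt).1 mulr1.
Qed.
End Charts.

(** * Linear forms, points and lines *)

Lemma sum_ord3 (V : nmodType) (F : 'I_3 -> V) : \sum_k F k = F 0 + F 1 + F 2.
Proof.
rewrite !big_ord_recl big_ord0 addr0 addrA.
by congr (F _ + F _ + F _); apply: val_inj.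
Qed.

Section LinearForms.
Variables (K : fieldType) (n : nat).
Implicit Types (c : 'cV[K]_n) (x : 'rV[K]_n).

Definition linear_form c : {mpoly K[n]} := \sum_i c i 0 *: mpolyX K (mnm1 i).

Lemma linear_form_homog c : linear_form c \is 1.-homog.
Proof.
apply: rpred_sum => i _; apply: rpredZ.
by rewrite dhomogX; apply/eqP; exact: mdeg1.
Qed.

Lemma linear_form_mcoeff (q : {mpoly K[n]}) :
  q \is 1.-homog -> q = linear_form (\col_i mcoeff (mnm1 i) q).
Proof.
move=> q1; apply/mpolyP => m; rewrite /linear_form raddf_sum /=.
under eq_bigr do rewrite mcoeffZ mcoeffX mxE.
have [/mdeg1P[i /eqP ->]|m1] := boolP (mdeg m == 1%N).
  rewrite (bigD1 i) //= eqxx mulr1 big1 ?addr0 // => j ji.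
  rewrite (_ : (_ == _) = false) ?mulr0 //.
  apply: contraNF ji => /eqP/(congr1 (fun m : multinom n => m j)).
  by rewrite !mnm1E eqxx eq_sym; case: (_ == _).
rewrite (dhomog_nemf_coeff q1) // big1 // => i _.
rewrite (_ : (_ == _) = false) ?mulr0 //.
by apply: contraNF m1 => /eqP <-; rewrite mdeg1.
Qed.

Lemma linear_formD a c b c' :
  linear_form (a *: c + b *: c') = a *: linear_form c + b *: linear_form c'.
Proof.
rewrite /linear_form !scaler_sumr -big_split /=; apply: eq_bigr => i _.
by rewrite !mxE scalerDl !scalerA.
Qed.

Lemma meval_linear_form x c : meval (x 0) (linear_form c) = (x *m c) 0 0.
Proof.
rewrite /linear_form raddf_sum mxE /=; apply: eq_bigr => i _.
by rewrite mevalZ mevalXU mulrC.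
Qed.

Lemma mderiv_linear_form_exp k c d :
  mderiv k (linear_form c ^+ d) = (c k 0 *+ d) *: linear_form c ^+ d.-1.
Proof.
have dl : mderiv k (linear_form c) = mpolyC n (c k 0).
  rewrite /linear_form raddf_sum (bigD1 k) //= big1 => [|i ik].
    rewrite mderivZ mderivX mnm1E eqxx addr0 -mul_mpolyC.
    rewrite (_ : mnm_sub (mnm1 k) (mnm1 k) = mnm0) ?mpolyX0 ?scale1r ?mulr1 //.
    by apply/mnmP => i; rewrite mnmBE subnn mnm0E.
  by rewrite mderivZ mderivX mnm1E (negbTE ik) scale0r scaler0.
elim: d => [|d IHd]; first by rewrite expr0 -mpolyC1 mderivC mulr0n scale0r.
rewrite exprS mderivM dl IHd mul_mpolyC /= -scalerAr mulrS scalerDl; congr (_ + _).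
by case: d {IHd} => [|d]; rewrite ?mulr0n ?scale0r // exprS.
Qed.

(** The base field has characteristic zero. *)
Lemma mderiv0_omits_variable (R : realType) (f : {mpoly R[i][n]}) k :
  mderiv k f = 0 -> omits_variable f k.
Proof.
move=> df m; rewrite mcoeff_msupp; apply: contraNeq; rewrite -lt0n => mk.
have mE : m = mnm_add (mnm_sub m (mnm1 k)) (mnm1 k).
  apply/mnmP => i; rewrite mnmDE mnmBE mnm1E; case: eqP => [<-|_] /=.
    by rewrite subnK.
  by rewrite subn0 addn0.
have := congr1 (mcoeff (mnm_sub m (mnm1 k))) df.
rewrite mcoeff_deriv -mE mcoeff0 => /eqP.
by rewrite mulrn_eq0.
Qed.
End LinearForms.

Section Decompositions.
Context {R : realType}.
Local Notation C := R[i].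
Implicit Types (x p : 'rV[C]_3) (c : 'cV[C]_3).

Lemma waring_rank_le_size n d (f : {mpoly C[n]}) r (s : seq {mpoly C[n]}) :
  has_waring_rank d f r -> (forall q, q \in s -> q \is 1.-homog) ->
  f = \sum_(q <- s) q ^+ d -> (r <= size s)%N.
Proof.
move=> [_ minr] s1 fE; apply: (minr _ (tnth (in_tuple s))); split=> [j|].
  by apply: s1; exact: mem_tnth.
by rewrite fE big_tnth.
Qed.

Lemma linear_change_linear_form (A : 'M[C]_3) c :
  linear_change A (linear_form c) = linear_form (A^T *m c).
Proof.
rewrite /linear_change /linear_form raddf_sum /=.
under eq_bigr => i _.
  rewrite comp_mpolyZ comp_mpolyXU -tnth_nth tnth_mktuple scaler_sumr.
  over.
rewrite exchange_big /=; apply: eq_bigr => j _.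
rewrite mxE scaler_suml; apply: eq_bigr => i _.
by rewrite scalerA mxE mulrC.
Qed.

Lemma invertible_with_first_column p : p != 0 ->
  exists A : 'M[C]_3, A \in unitmx /\ exists a : C, col 0 A = a *: p^T.
Proof.
move=> p0; exists (row_ebase p)^T; rewrite unitmx_tr row_ebase_unit; split => //.
have rp : \rank p = 1%N by rewrite rank_rV p0.
exists (col_ebase p 0 0)^-1.
have e0 : col_ebase p 0 0 != 0.
  by have := col_ebase_unit p; rewrite unitmxE det_mx11 unitfE.
apply/matrixP => i j; rewrite [j]ord1 !mxE -{3}(mulmx_ebase p) rp.
rewrite mxE (bigD1 0) //= big1 => [|k k0].
  by rewrite addr0 !mxE big_ord1 !mxE /= mulr1 mulKf.
rewrite !mxE big_ord1 !mxE /=.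
by rewrite -val_eqE eq_sym /= in k0; rewrite (negbTE k0) /= mulr0 mul0r.
Qed.

(** If all the forms vanished at [p], then [f] would omit a variable in
coordinates having [p] on an axis. The factor [d] also covers [d = 0], where [f]
is constant. *)
Lemma essential_no_common_point d r (c : 'I_r -> 'cV[C]_3) p : p != 0 ->
  essentially_involves_all_variables (\sum_j linear_form (c j) ^+ d) ->
  exists j, (p *m c j) 0 0 *+ d != 0.
Proof.
move=> p0 ess; apply: contrapT => /forallNP pc; apply: ess.
have [A [uA [a Ap]]] := invertible_with_first_column p0.
exists A; split => //; exists 0; apply: mderiv0_omits_variable.
rewrite /linear_change rmorph_sum /= raddf_sum big1 //= => j _.
rewrite rmorphXn /= -/(linear_change _ _) linear_change_linear_form.
rewrite mderiv_linear_form_exp.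
have /negP := pc j; rewrite negbK => /eqP pcj.
have -> : (A^T *m c j) 0 0 = a * (p *m c j) 0 0.
  have := congr1 (fun B : 'cV_3 => B^T *m c j) Ap; rewrite tr_col linearZ /= trmxK.
  rewrite -row_mul -scalemxAl => /matrixP/(_ 0 0).
  by rewrite !mxE.
by rewrite -mulrnAr pcj mulr0 scale0r.
Qed.

(** Only an inequality holds in general, since several forms may define the same
line. *)
Lemma card_lines_through r (l : 'I_r -> {mpoly C[3]}) p m :
  has_multiplicity (line_arrangement l) p m ->
  (m <= #|[pred j | meval (p 0%R) (l j) == 0%R]|)%N.
Proof.
set J := [pred j | _]; rewrite /has_multiplicity => /card_eqPle[_ ].
pose g := nth set0 [seq zero_locus (l j) | j <- enum J].
rewrite -card_le_II => /card_le_trans; apply.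
apply: card_le_trans (card_image_le g `I_#|J|).
apply: subset_card_le => _ [[j _ <-] lp].
have jJ : j \in enum J by rewrite mem_enum inE; apply/eqP.
exists (index j (enum J)); first by rewrite /= cardE index_mem.
by rewrite /g (nth_map j) ?index_mem // nth_index.
Qed.

(** The middle vector is any element of the plane [c = 0] which is not a multiple
of [q]. *)
Lemma adapted_basis c p (q : 'rV[C]_3) :
  (p *m c) 0 0 != 0 -> q != 0 -> (q *m c) 0 0 = 0 ->
  exists M : 'M[C]_3, [/\ M \in unitmx, row 0 M = q, (row 1 M *m c) 0 0 = 0 &
    row 2 M = p].
Proof.
move=> pc q0 qc.
have rk2 : (2 <= \rank (kermx c))%N.
  by rewrite mxrank_ker (leq_trans _ (leq_sub2l 3 (rank_leq_col c))).
have /row_subPn[i nq] : ~~ (kermx c <= q)%MS.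
  apply: contraL rk2 => /mxrankS; rewrite -ltnNge ltnS => /leq_trans; apply.
  exact: rank_leq_row.
pose e := row i (kermx c).
have ec : e *m c = 0 by rewrite -row_mul mulmx_ker row0.
pose M : 'M[C]_3 := \matrix_j [:: q; e; p]`_j.
have rM0 : row 0 M = q by rewrite rowK.
have rM1 : row 1 M = e by rewrite rowK.
have rM2 : row 2 M = p by rewrite rowK.
exists M; split => //; last by rewrite rM1 ec mxE.
rewrite -row_free_unit; apply: inj_row_free => v.
have -> : v *m M = v 0 0 *: q + v 0 1 *: e + v 0 2 *: p.
  by rewrite mulmx_sum_row sum_ord3 rM0 rM1 rM2.
move=> vM; have v2 : v 0 2 = 0.
  have qc0 : q *m c = 0 by apply/matrixP => i1 j1; rewrite !ord1 qc mxE.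
  have := congr1 (fun u : 'rV_3 => (u *m c) 0 0) vM.
  rewrite /= !mulmxDl -!scalemxAl ec qc0 mul0mx !scaler0 !add0r.
  rewrite [LHS]mxE [RHS]mxE => /eqP; rewrite mulf_eq0 (negbTE pc) orbF.
  by move=> /eqP.
move: vM; rewrite v2 scale0r addr0 => vM.
have v1 : v 0 1 = 0.
  apply: contraNeq nq => v1; rewrite -/e -(scale1r e) -(mulVf v1) -scalerA.
  apply: scalemx_sub; rewrite (_ : _ *: e = - v 0 0 *: q);
    first exact/scalemx_sub/submx_refl.
  by apply/eqP; rewrite scaleNr -addr_eq0 addrC vM.
move: vM; rewrite v1 scale0r addr0 => /eqP; rewrite scaler_eq0 (negbTE q0) orbF.
move=> /eqP v0; apply/rowP => -[[|[|[|j]]] j3] //; rewrite [RHS]mxE.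
- by rewrite -[RHS]v0; congr (v 0 _); apply: val_inj.
- by rewrite -[RHS]v1; congr (v 0 _); apply: val_inj.
- by rewrite -[RHS]v2; congr (v 0 _); apply: val_inj.
Qed.

Lemma nonzero_in_kernel c : exists2 q : 'rV[C]_3, q != 0 & (q *m c) 0 0 = 0.
Proof.
have : kermx c != 0.
  rewrite -mxrank_eq0 mxrank_ker -lt0n subn_gt0.
  exact: leq_ltn_trans (rank_leq_col c) _.
case/rowV0Pn => q /sub_kermxP qc q0; exists q => //.
by rewrite qc mxE.
Qed.
End Decompositions.

(** * Decompositions with all but one form through a point *)

Section Frames.
Context {R : realType} {r : nat}.
Local Notation C := R[i].
Implicit Types (c : 'I_r -> 'cV[C]_3) (M : 'M[C]_3) (f : {mpoly C[3]}).

(** The rows of [M] are the vectors [q, e, p] of the basis: the form [c j0] is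
the third dual coordinate, the other forms involve the first two only. *)
Definition adapted_frame c (j0 : 'I_r) M : Prop :=
  [/\ M \in unitmx, (row 0 M *m c j0) 0 0 = 0, (row 1 M *m c j0) 0 0 = 0,
      (row 2 M *m c j0) 0 0 = 1 &
      forall j, j != j0 -> (row 2 M *m c j) 0 0 = 0].

Definition frame_moment d c j0 M : nat -> C :=
  moment d (predC1 j0) (fun j => (row 0 M *m c j) 0 0)
                       (fun j => (row 1 M *m c j) 0 0).

(** The columns of [invmx M] are the coordinates dual to the rows of [M]. *)
Lemma frame_expansion M (u : 'cV[C]_3) : M \in unitmx ->
  u = (row 0 M *m u) 0 0 *: col 0 (invmx M) + (row 1 M *m u) 0 0 *: col 1 (invmx M)
      + (row 2 M *m u) 0 0 *: col 2 (invmx M).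
Proof.
move=> uM; rewrite -{1}(mulKmx uM u); apply/colP => i.
rewrite [LHS]mxE sum_ord3 [RHS]mxE [X in _ = X + _]mxE.
by congr (_ + _ + _); rewrite [RHS]mxE -row_mul [X in _ = X * _]mxE
  [X in _ = _ * X]mxE mulrC.
Qed.

Lemma adapted_decomposition d c j0 M : adapted_frame c j0 M ->
  \sum_j linear_form (c j) ^+ d =
  linear_form (col 2 (invmx M)) ^+ d +
  \sum_(j | j != j0)
    ((row 0 M *m c j) 0 0 *: linear_form (col 0 (invmx M)) +
     (row 1 M *m c j) 0 0 *: linear_form (col 1 (invmx M))) ^+ d.
Proof.
move=> [uM M0 M1 M2 Mj].
have c0E : c j0 = col 2 (invmx M).
  rewrite [LHS](frame_expansion (c j0) uM) M0 M1 M2.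
  by rewrite !scale0r !add0r scale1r.
rewrite (bigD1 j0) //= {1}c0E; apply: f_equal.
apply: eq_bigr => j jj0; rewrite -linear_formD.
have cjE := frame_expansion (c j) uM; rewrite Mj // scale0r addr0 in cjE.
by rewrite -cjE.
Qed.

Lemma adapted_rank_le d c j0 M : adapted_frame c j0 M -> (0 < d)%N ->
  has_waring_rank d (\sum_j linear_form (c j) ^+ d) r -> (r <= d.+1)%N.
Proof.
move=> fr d0 rk; have fE := adapted_decomposition d fr.
have [a [b ab]] := binary_form_rank_le (predC1 j0)
  (fun j => (row 0 M *m c j) 0 0) (fun j => (row 1 M *m c j) 0 0) d0.
rewrite ab in fE.
pose s := linear_form (col 2 (invmx M)) ::
  [seq a i *: linear_form (col 0 (invmx M)) + b i *: linear_form (col 1 (invmx M))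
     | i <- enum 'I_d].
have -> : d.+1 = size s by rewrite /= size_map size_enum_ord.
apply: (waring_rank_le_size rk) => [q|]; last first.
  by rewrite fE big_cons big_map big_enum.
rewrite inE => /orP[/eqP->|/mapP[i _ ->]]; first exact: linear_form_homog.
by rewrite -linear_formD linear_form_homog.
Qed.

(** Otherwise [moments_vanish] leaves [f = Z ^ d + S_d Y ^ d], a sum of two
powers. *)
Lemma adapted_moment_neq0 d c j0 M : adapted_frame c j0 M ->
  (2 < r <= d.+1)%N ->
  has_waring_rank d (\sum_j linear_form (c j) ^+ d) r ->
  exists k, (k < r.-1)%N && (frame_moment d c j0 M k != 0).
Proof.
move=> fr /andP[r2 rd] rk; apply/not_existsP => S0.
have cP : #|predC1 j0| = r.-1 by rewrite cardC1 card_ord.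
have d0 : (0 < d)%N by rewrite -ltnS (leq_trans _ rd) // ltnW.
have S0' k : (k < d)%N -> frame_moment d c j0 M k = 0.
  apply: moments_vanish; rewrite cP.
    by rewrite -ltnS prednK // (ltn_trans _ r2).
  move=> k' k'r; apply/eqP; apply: contraT => Sk'.
  by case: (S0 k'); rewrite k'r.
have gE (x y : {mpoly C[3]}) : \sum_(j | j != j0)
    ((row 0 M *m c j) 0 0 *: x + (row 1 M *m c j) 0 0 *: y) ^+ d =
    frame_moment d c j0 M d *: y ^+ d.
  rewrite (sum_powers_moments d (predC1 j0)) big_ord_recr /= big1 => [|k _].
    by rewrite subnn expr0 mul1r binn mulr1n add0r.
  by have := S0' k (ltn_ord k); rewrite /frame_moment => ->; rewrite scale0r.
have fE := adapted_decomposition d fr; rewrite gE in fE.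
pose t := d.-root (frame_moment d c j0 M d).
suff : (r <= 2)%N by rewrite leqNgt r2.
apply: (@waring_rank_le_size _ _ _ _ _ [:: linear_form (col 2 (invmx M));
  t *: linear_form (col 1 (invmx M))] rk) => [q|].
  rewrite !inE => /orP[] /eqP ->; first exact: linear_form_homog.
  by apply: rpredZ; exact: linear_form_homog.
by rewrite fE !big_cons big_nil addr0 exprZn rootCK //.
Qed.

(** The derivative of [f] at [q] in the direction [v]. *)
Lemma singular_point_direction d c (q v : 'rV[C]_3) :
  singular_point (\sum_j linear_form (c j) ^+ d) q ->
  \sum_j (q *m c j) 0 0 ^+ d.-1 * (v *m c j) 0 0 *+ d = 0.
Proof.
move=> [_ _ df].
have dE k : \sum_j (q *m c j) 0 0 ^+ d.-1 * c j k 0 *+ d = 0.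
  rewrite -[RHS](df k) [mderiv k _]raddf_sum [meval _ _]raddf_sum /=.
  apply: eq_bigr => j _.
  rewrite mderiv_linear_form_exp mevalZ rmorphXn /= meval_linear_form.
  by rewrite mulrC mulrnAl.
transitivity (\sum_k v 0 k * \sum_j (q *m c j) 0 0 ^+ d.-1 * c j k 0 *+ d).
  under [RHS]eq_bigr do rewrite mulr_sumr.
  rewrite exchange_big /=; apply: eq_bigr => j _.
  rewrite [X in _ * X]mxE mulr_sumr -sumrMnl; apply: eq_bigr => k _.
  by rewrite -mulrnAr [in RHS]mulrCA mulrnAr mulrnAr.
by rewrite big1 // => k _; rewrite dE mulr0.
Qed.

Lemma adapted_germ d m c j0 M k : adapted_frame c j0 M -> (m <= d)%N ->
  (0 < d)%N -> (forall i, (i < m)%N -> frame_moment d c j0 M i = 0) ->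
  frame_moment d c j0 M m != 0 -> M 0 k != 0 ->
  germ_of_type m d
    (fun y => meval (chart_inv k y) (\sum_j linear_form (c j) ^+ d))
    (chart_point k (row 0 M)).
Proof.
move=> fr md d0 S0 Sm Mk; have [h h0 GE] := binary_poly_order md S0 Sm.
have [uM _ _ _ _] := fr.
apply: (germ_of_type_adapted d0 h0 uM Mk) => x u u0.
have uE i : meval (x 0) (linear_form (col i (invmx M))) = u 0 i.
  by rewrite meval_linear_form !mxE; apply: eq_bigr => k' _; rewrite mxE.
rewrite (adapted_decomposition d fr) mevalD rmorphXn
  [meval _ (\sum_(_ | _) _)]raddf_sum /=.
rewrite uE addrC mulrDr; congr (_ + _); last by rewrite -exprMn mulrC divfK.
have := congr1 (fun p : {poly C} => p.[u 0 1 / u 0 0]) GE.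
rewrite hornerM hornerXn horner_sum => <-.
rewrite mulr_sumr; apply: eq_bigr => j _.
rewrite rmorphXn rmorphD /= !mevalZ !uE horner_exp -exprMn; congr (_ ^+ _).
rewrite hornerD !hornerZ hornerX hornerC mulr1 mulrDr mulrC; congr (_ + _).
by rewrite mulrCA [u 0 0 * _]mulrC divfK.
Qed.

End Frames.

Theorem corollary4p2 (R : realType) (d r : nat) (f : {mpoly R[i][3]})
    (l : 'I_r -> {mpoly R[i][3]})
    (f_homog : f \is d.-homog)
    (f_reduced : reduced f)
    (f_essential : essentially_involves_all_variables f)
    (f_rank : has_waring_rank d f r)
    (r_ge4 : (4 <= r)%N)
    (f_decomp : waring_decomposition d f l)
    (mult_point : exists p : 'rV[R[i]]_3,
       p != 0 /\ has_multiplicity (line_arrangement l) p r.-1) :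
  (smooth_curve f \/
   forall p : 'rV[R[i]]_3, singular_point f p ->
     exists m : nat, (2 <= m <= r - 2)%N /\ singularity_of_type m d f p) /\
  (r <= d.+1)%N.
Proof.
have [_ [l1 fE]] := f_decomp.
pose c j : 'cV_3 := \col_i mcoeff (mnm1 i) (l j).
have lE j : l j = linear_form (c j) by exact/linear_form_mcoeff/l1.
have {}fE : f = \sum_j linear_form (c j) ^+ d.
  by rewrite fE; apply: eq_bigr => j _; rewrite lE.
have [p0 [p0_neq0 p0_mult]] := mult_point.
rewrite fE in f_essential f_rank *.
have [j0] := essential_no_common_point p0_neq0 f_essential.
rewrite mulrn_eq0 negb_or -lt0n => /andP[d0 pj0].
have p0j j : j != j0 -> (p0 *m c j) 0 0 = 0.
  have := card_lines_through p0_mult; set J := [pred j | _] => cJ jj0.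
  have sJ : J \subset predC1 j0.
    apply/fintype.subsetP => i; rewrite !inE lE meval_linear_form.
    by apply: contraTneq => ->.
  have : j \in J.
    have /geq_leqif := subset_leqif_card sJ.
    rewrite cardC1 card_ord cJ => /esym/fintype.subsetP -> //.
  by rewrite inE lE meval_linear_form => /eqP.
(* p0 is rescaled so that the form c j0 takes the value 1 at p. *)
have frame q : q != 0 -> (q *m c j0) 0 0 = 0 ->
    exists2 M, adapted_frame c j0 M & row 0 M = q.
  move=> q0 qj0; pose p := ((p0 *m c j0) 0 0)^-1 *: p0.
  have pE j : (p *m c j) 0 0 = ((p0 *m c j0) 0 0)^-1 * (p0 *m c j) 0 0.
    by rewrite -scalemxAl mxE.
  have pj1 : (p *m c j0) 0 0 = 1 by rewrite pE mulVf.
  have pj1' : (p *m c j0) 0 0 != 0 by rewrite pj1 oner_neq0.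
  have [M [uM M0 M1 M2]] := adapted_basis pj1' q0 qj0.
  exists M => //; split; rewrite ?M0 ?M2 // => j jj0.
  by rewrite pE (p0j j) // mulr0.
have rd : (r <= d.+1)%N.
  have [q q0 qj0] := nonzero_in_kernel (c j0).
  have [M fr _] := frame q q0 qj0.
  exact: adapted_rank_le fr d0 f_rank.
split=> //; right => q q_sing; have [q0 fq _] := q_sing.
(* Along p0 only the form c j0 varies. *)
have qj0 : (q *m c j0) 0 0 = 0.
  have := singular_point_direction p0 q_sing.
  rewrite (bigD1 j0) //= big1 => [|j jj0]; last by rewrite p0j // mulr0 mul0rn.
  rewrite addr0 => /eqP; rewrite mulrn_eq0 eqn0Ngt d0 mulf_eq0 (negbTE pj0) orbF.
  by rewrite expf_eq0 => /andP[_ /eqP].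
have [M fr M0] := frame q q0 qj0.
have [uM M0j0 M1j0 M2j0 M2j] := fr.
have r2 : (2 < r <= d.+1)%N by rewrite rd (ltn_trans _ r_ge4).
have exS := adapted_moment_neq0 fr r2 f_rank.
case: (ex_minnP exS) => m /andP[mr Sm] m_min.
have S0 k : (k < m)%N -> frame_moment d c j0 M k = 0.
  move=> km; apply/eqP; apply: contraTT km => Sk; rewrite -leqNgt.
  have [kr|rk] := ltnP k r.-1; first by rewrite m_min ?kr.
  by rewrite (leq_trans (ltnW mr)).
have md : (m <= d)%N.
  by rewrite -ltnS (leq_trans _ rd) // (leq_trans mr) ?leq_pred.
have S_0 : frame_moment d c j0 M 0 = 0.
  have := fq; rewrite /zero_locus /= raddf_sum /= (bigD1 j0) //= rmorphXn /=.
  rewrite meval_linear_form qj0 expr0n eqn0Ngt d0 add0r => <-.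
  apply: eq_bigr => j _; rewrite rmorphXn /= meval_linear_form M0 subn0.
  by rewrite expr0 mulr1.
have S_1 : frame_moment d c j0 M 1 = 0.
  have := singular_point_direction (row 1 M) q_sing; rewrite sumrMnl.
  move=> /eqP; rewrite mulrn_eq0 eqn0Ngt d0 /= (bigD1 j0) //= M1j0 mulr0 add0r.
  move=> /eqP S1; rewrite -[RHS]S1; apply: eq_bigr => j _.
  by rewrite M0 subn1 expr1.
exists m; split.
  apply/andP; split; last by rewrite subn2 -ltnS prednK // (leq_ltn_trans _ mr).
  by case: m Sm {mr m_min S0 md} => [|[|]]; rewrite ?S_0 ?S_1 ?eqxx.
split=> // k qk; rewrite -M0; apply: adapted_germ fr md d0 S0 Sm _.
by rewrite -M0 mxE in qk.
Qed.
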